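(* Fix $\delta\in(0,1)$. Consider the detection problem $\mathsf{PDBS}(n,k_R,k_L,p,q)$ described in the context, and suppose that $|p-q|=O(q)$ and $q<c$ for some constant $0<c<1$. Let $A$ be the adjacency matrix of the observed graph. Then: 1. For the scan test $\phi_{\mathrm{Scan}}=\mathbb{1}\{\mathrm{Scan}(A)\ge\tau_{\mathrm{Scan}}\}$ with $\tau_{\mathrm{Scan}}=k_Rk_L\frac{p+q}{2}$, we have $\mathsf{R}_n(\phi_{\mathrm{Scan}})\le\delta$ provided that $$\chi^2(p\|q)=\Omega\left(\frac{\log\left(\frac{n}{k_R\vee k_L}\right)+\frac{\log(2/\delta)}{k_R\vee k_L}}{k_R\wedge k_L}\right).$$ 2. For the count test $\phi_{\mathrm{Count}}=\mathbb{1}\{\mathrm{Count}(A)\ge\tau_{\mathrm{Count}}\}$ with $\tau_{\mathrm{Count}}=\binom n2 q+k_Rk_L\frac{p-q}{2}$, we have $\mathsf{R}_n(\phi_{\mathrm{Count}})\le\delta$ provided that $$\chi^2(p\|q)=\Omega\left(\frac{n^2}{k_R^2k_L^2}\log\frac{2}{\delta}\right).$$ 3. For the degree test $\phi_{\mathrm{Deg}}=\mathbb{1}\{\mathrm{MaxDeg}(A)\ge\tau_{\mathrm{Deg}}\}$ with $\tau_{\mathrm{Deg}}=(n-1)q+(k_R\vee k_L)\frac{p-q}{2}$, we have $\mathsf{R}_n(\phi_{\mathrm{Deg}})\le\delta$ provided that $$\chi^2(p\|q)=\Omega\left(\frac{n}{k_R^2\vee k_L^2}\left(\log n+\log\fr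ac{2}{\delta}\right)\right).$$
   Context: Detection problem $\mathsf{PDBS}(n,k_R,k_L,p,q)$: the observation is a simple undirected graph $G$ on vertex set $[n]$ with adjacency matrix $A$. Under $\mathcal{H}_0$, $G\sim\mathcal{G}(n,q)$ (each edge independently with probability $q$). Under $\mathcal{H}_1$: a set $\mathcal{R}\subset[n]$ of size $k_R$ is chosen uniformly at random, then $\mathcal{L}\subseteq[n]\setminus\mathcal{R}$ of size $k_L$ uniformly at random; each pair with one endpoint in $\mathcal{R}$ and the other in $\mathcal{L}$ is an edge independently with probability $p$, every other pair independently with probability $q$. Standing assumptions: $0<q<p$, and $n\to\infty$ with $k_R+k_L=o(n)$ ($k_R,k_L,p,q$ may depend on $n$). Risk of a test $\phi$: $\mathsf{R}_n(\phi)=\mathbb{P}_{\mathcal{H}_0}(\phi(G)=1)+\mathbb{P}_{\mathcal{H}_1}(\phi(G)=0)$. $\chi^2(p\|q)=\frac{(p-q)^2}{q(1-q)}$. Statistics: $\mathrm{Scan}(A)=\max_{(\mathcal{R}',\mathcal{L}')}\sum_{i\in\mathcal{R}',j\in\mathcal{L}'}A_{ij}$, the maximum over pairs of disjoint sets $\mathcal{R}',\mathcal{L}'\subset[n]$ with $|\mathcal{R}'|=k_R$, $|\mathcal{L}'|=k_L$; $\mathrm{Count}(A)=\sum_{i<j}A_{ij}$; $\mathrm{MaxDeg}(A)=\max_{1\le i\le n}\sum_{j=1}^nA_{ij}$. $a\vee b=\max\{a,b\}$, $a\wedge b=\min\{a,b\}$. A condition ''$\chi^2(p\|q)=\Omega(f)$''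 means $\chi^2(p\|q)\ge Cf$ for a suitable absolute constant $C>0$. *)

(* Defs.v *)
From HB Require Import structures.
From mathcomp Require Import all_boot all_order all_algebra.
From mathcomp Require Import all_classical all_reals all_analysis.
Set Implicit Arguments.
Unset Strict Implicit.
Unset Printing Implicit Defensive.
Import Order.TTheory GRing.Theory Num.Theory.
Local Open Scope ring_scope.

(* Simple undirected graphs on [n], given by their adjacency matrix. *)
Definition simple_adj n (A : 'M[bool]_n) : bool :=
  [forall i, ~~ A i i] && [forall i, forall j, A i j == A j i].

Definition graph n := {A : 'M[bool]_n | simple_adj A}.

HB.instance Definition _ n := Finite.on (graph n).

Definition adj n (G : graph n) (i j : 'I_n) : bool := val G i j.

(* Law of the graph in which the pairs i < j are edges independently, with
   probability w i j; the values of w elsewhere are irrelevant. *)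
Definition edge_law (R : realType) n (w : 'I_n -> 'I_n -> R) (G : graph n) : R :=
  \prod_(e : 'I_n * 'I_n | (e.1 < e.2)%N)
    (if adj G e.1 e.2 then w e.1 e.2 else 1 - w e.1 e.2).

Definition null_law (R : realType) n (q : R) : graph n -> R :=
  edge_law (fun _ _ => q).

Definition planted_prob (R : realType) n (p q : R) (S T : {set 'I_n})
    (i j : 'I_n) : R :=
  if (i \in S) && (j \in T) || (i \in T) && (j \in S) then p else q.

(* S is uniform among the kR-subsets of [n] and, given S, T is uniform among
   the kL-subsets of its complement. *)
Definition planted_law (R : realType) n (kR kL : nat) (p q : R)
    (G : graph n) : R :=
  \sum_(S : {set 'I_n} | #|S| == kR) ('C(n, kR)%:R)^-1 *
    \sum_(T : {set 'I_n} | (T \subset ~: S) && (#|T| == kL))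
      ('C(n - kR, kL)%:R)^-1 * edge_law (planted_prob p q S T) G.

Definition prob (R : realType) n (law : graph n -> R) (E : pred (graph n)) : R :=
  \sum_(G : graph n | E G) law G.

(* A test answers true when it rejects the null hypothesis. *)
Definition risk (R : realType) n (kR kL : nat) (p q : R)
    (phi : graph n -> bool) : R :=
  prob (null_law q) [pred G | phi G] +
  prob (planted_law kR kL p q) [pred G | ~~ phi G].

Definition chi2 (R : realType) (p q : R) : R := (p - q) ^+ 2 / (q * (1 - q)).

Definition scan n (kR kL : nat) (G : graph n) : nat :=
  (\max_(ST : {set 'I_n} * {set 'I_n}
          | [&& #|ST.1| == kR, #|ST.2| == kL & [disjoint ST.1 & ST.2]])
     \sum_(i in ST.1) \sum_(j in ST.2) adj G i j)%N.

Definition edge_count n (G : graph n) : nat :=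
  (\sum_(e : 'I_n * 'I_n | e.1 < e.2) adj G e.1 e.2)%N.

Definition max_deg n (G : graph n) : nat :=
  (\max_(i < n) \sum_(j < n) adj G i j)%N.

Definition scan_test (R : realType) n (kR kL : nat) (p q : R)
    (G : graph n) : bool :=
  (kR * kL)%:R * ((p + q) / 2) <= (scan kR kL G)%:R.

Definition count_test (R : realType) n (kR kL : nat) (p q : R)
    (G : graph n) : bool :=
  'C(n, 2)%:R * q + (kR * kL)%:R * ((p - q) / 2) <= (edge_count G)%:R.

Definition deg_test (R : realType) n (kR kL : nat) (p q : R)
    (G : graph n) : bool :=
  (n%:R - 1) * q + (maxn kR kL)%:R * ((p - q) / 2) <= (max_deg G)%:R.

(* Main.v *)
(* All three statistics are sums of independent Bernoulli variables over a set of
   edges, or maxima of such sums. Chernoff's method with e^x <= 1 + x + 2 x^2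
   gives both tails exp(- t^2 / (8 V)) whenever V bounds the mean and
   t <= 2 V; as p <= (1 + M) q, one may take V = (1 + M) m q for (at most) m
   edges, under both hypotheses. The threshold lies t = s (p - q) / 2 away from both
   means, where s is the number of planted edges counted by the statistic: k_R k_L for
   the scan and the count, and k_R \/ k_L for a vertex of the smaller planted
   side. Under the null hypothesis the scan costs a union bound over
   'C(n, kR) 'C(n, kL) <= exp(4 k ln(n / k)) pairs, with k = k_R \/ k_L <= n / 4,
   and the maximal degree one over n vertices. *)

Require Import Defs.
From HB Require Import structures.
From mathcomp Require Import all_boot all_order all_algebra.
From mathcomp Require Import all_classical all_reals all_analysis.
From mathcomp Require Import ring lra.
Set Implicit Arguments.
Unset Strict Implicit.
Unset Printing Implicit Defensive.
Import Order.TTheory GRing.Theory Num.Theory.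
Import numFieldNormedType.Exports.
Local Open Scope ring_scope.

(** * Graphs as independent choices over the pairs [i < j] *)

Lemma adjC n (G : graph n) (i j : 'I_n) : adj G i j = adj G j i.
Proof. by have /andP[_ /forallP/(_ i)/forallP/(_ j)/eqP] := valP G. Qed.

Lemma adjii n (G : graph n) (i : 'I_n) : adj G i i = false.
Proof. by have /andP[/forallP/(_ i)/negbTE] := valP G. Qed.

(** The value is forced to [false] off the pairs [i < j], so that a graph has exactly one code;
    [graph_of] decodes it. *)
Definition upper_adj n (G : graph n) : {ffun 'I_n * 'I_n -> bool} :=
  [ffun e : 'I_n * 'I_n => (e.1 < e.2)%N && adj G e.1 e.2].

Definition sym_mx n (f : {ffun 'I_n * 'I_n -> bool}) : 'M[bool]_n :=
  \matrix_(i, j) ((i < j)%N && f (i, j) || (j < i)%N && f (j, i)).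

Lemma sym_mx_simple n (f : {ffun 'I_n * 'I_n -> bool}) : simple_adj (sym_mx f).
Proof.
apply/andP; split; first by apply/forallP => i; rewrite mxE ltnn.
by apply/forallP => i; apply/forallP => j; rewrite !mxE orbC.
Qed.

Definition graph_of n (f : {ffun 'I_n * 'I_n -> bool}) : graph n :=
  exist _ (sym_mx f) (sym_mx_simple f).

(** Distributivity: expanding the right-hand product selects a boolean for each pair [i < j], which
    is the same as selecting a graph. This is how independence of the edges enters. *)
Lemma sum_graph_prod (R : comRingType) n (f : 'I_n * 'I_n -> bool -> R) :
  \sum_(G : graph n)
     \prod_(e : 'I_n * 'I_n | (e.1 < e.2)%N) f e (adj G e.1 e.2) =
  \prod_(e : 'I_n * 'I_n | (e.1 < e.2)%N) (f e true + f e false).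
Proof.
under [RHS]eq_bigr do rewrite -big_bool.
(* The default [false] outside the index set agrees with [upper_adj], so its functions are exactly
   the codes of graphs. *)
rewrite (big_distr_big_dep false) (reindex_onto (@upper_adj n) (@graph_of n)).
  apply: eq_big => [G|G _]; last first.
    by apply: eq_bigr => -[i j] /= ij; rewrite ffunE /= ij.
  symmetry; apply/andP; split.
    apply/pfamilyP; split => //; apply/fintype.subsetP => e.
    by rewrite inE ffunE unfold_in; case: (_ < _)%N.
  apply/eqP/val_inj/matrixP => i j; rewrite !mxE !ffunE /= -[val G]/(val G).
  rewrite -/(adj G i j) (adjC G j i).
  case: ltngtP => /= [ij|ij|/val_inj ->]; by rewrite ?orbF ?adjii.
move=> g /pfamilyP[/fintype.subsetP supp _]; apply/ffunP => -[i j].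
rewrite ffunE /= /adj mxE.
case: ltngtP => //= ij; rewrite ?orbF //; symmetry; apply/negbTE/negP => gij.
  by have := supp (i, j); rewrite inE unfold_in /= gij => /(_ isT);
    rewrite ltnNge ltnW.
by have := supp (i, j); rewrite inE unfold_in /= gij => /(_ isT); rewrite ij ltnn.
Qed.

Definition crossing n (S T : {set 'I_n}) (e : 'I_n * 'I_n) : bool :=
  (e.1 \in S) && (e.2 \in T) || (e.1 \in T) && (e.2 \in S).

(** By disjointness, each unordered pair between [S] and [T] occurs once in the double sum. The
    terms with [i < j] are kept and the others are transposed. *)
Lemma sum_crossing (V : nmodType) n (S T : {set 'I_n}) (f : 'I_n -> 'I_n -> V) :
  [disjoint S & T] -> (forall i j, f i j = f j i) ->
  \sum_(i in S) \sum_(j in T) f i j =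
  \sum_(e : 'I_n * 'I_n | (e.1 < e.2)%N && crossing S T e) f e.1 e.2.
Proof.
move=> dST fC; have notST i : i \in S -> i \in T -> False.
  by move=> iS; rewrite (disjointFr dST iS).
rewrite pair_big /= (bigID (fun e : 'I_n * 'I_n => e.1 < e.2)%N) /=.
rewrite [RHS](bigID (fun e : 'I_n * 'I_n => (e.1 \in S) && (e.2 \in T))) /=.
congr (_ + _).
  apply: eq_bigl => -[i j] /=; rewrite /crossing /=.
  by case: (i \in S); case: (j \in T); rewrite ?andbF ?andbT.
rewrite (reindex (fun e : 'I_n * 'I_n => (e.2, e.1))) /=; last first.
  by exists (fun e => (e.2, e.1)) => -[].
apply: eq_big => [[i j]|[i j] _] //=; rewrite /crossing /=.
case iS: (i \in S); case jT: (j \in T); case iT: (i \in T); case jS: (j \in S);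
  rewrite ?andbF ?andbT ?orbT //=; try by case: (notST i).
  by case: (notST j).
(* The negation of [j < i] still allows [i = j], which is impossible as [j] lies in [S] and [i] does
   not. *)
rewrite -leqNgt leq_eqVlt; case: eqP => // /val_inj ij.
by move: iS; rewrite ij jS.
Qed.

(** * Exponential tail bounds for sums over edges *)

(** From [1 - x <= expR (- x)] one gets [expR x <= 1 / (1 - x)], and [(1 - x) (1 + x + 2 x^2)]
    exceeds 1 by [x^2 (1 - 2 x)]. Arbitrarily negative [x] is allowed, as lower tails require. *)
Lemma expR_quadratic (R : realType) (x : R) :
  x <= 1 / 2 -> expR x <= 1 + x + 2 * x ^+ 2.
Proof.
move=> x2; have x1 : 0 < 1 - x by lra.
have : (1 - x) * expR x <= 1.
  by rewrite -ler_pdivlMr ?expR_gt0// div1r -expRN; have := expR_ge1Dx (- x).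
move=> h; rewrite -(ler_pM2l x1); apply: le_trans h _.
rewrite -subr_ge0.
have -> : (1 - x) * (1 + x + 2 * x ^+ 2) - 1 = x ^+ 2 * (1 - 2 * x) by ring.
by apply: mulr_ge0; [exact: sqr_ge0|lra].
Qed.

Definition edge_stat (R : realType) n (E : pred ('I_n * 'I_n))
    (G : graph n) : R :=
  \sum_(e : 'I_n * 'I_n | (e.1 < e.2)%N && E e) (adj G e.1 e.2)%:R.

Definition edge_mean (R : realType) n (w : 'I_n -> 'I_n -> R)
    (E : pred ('I_n * 'I_n)) : R :=
  \sum_(e : 'I_n * 'I_n | (e.1 < e.2)%N && E e) w e.1 e.2.

Lemma edge_law_ge0 (R : realType) n (w : 'I_n -> 'I_n -> R) (G : graph n) :
  (forall i j, 0 <= w i j <= 1) -> 0 <= edge_law w G.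
Proof.
move=> w01; apply: prodr_ge0 => e _; have /andP[? ?] := w01 e.1 e.2.
by case: ifP => // _; rewrite subr_ge0.
Qed.

(** By independence the left side is a product over edges; an edge of [E] contributes
    [1 + w (expR lam - 1)], at most [expR (w (lam + 2 lam^2))]. The mean is replaced by [V] in the
    quadratic term only, so the linear one stays exact. *)
Lemma edge_stat_mgf (R : realType) n (w : 'I_n -> 'I_n -> R)
    (E : pred ('I_n * 'I_n)) (lam V : R) :
  (forall i j, 0 <= w i j <= 1) -> edge_mean w E <= V -> lam <= 1 / 2 ->
  \sum_(G : graph n) edge_law w G * expR (lam * edge_stat R E G) <=
  expR (lam * edge_mean w E + 2 * lam ^+ 2 * V).
Proof.
move=> w01 EV lam2.
pose f e (b : bool) : R := (if b then w e.1 e.2 else 1 - w e.1 e.2) *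
  (if E e then expR (lam * b%:R) else 1).
have -> : \sum_(G : graph n) edge_law w G * expR (lam * edge_stat R E G) =
    \sum_(G : graph n)
      \prod_(e : 'I_n * 'I_n | (e.1 < e.2)%N) f e (adj G e.1 e.2).
  apply: eq_bigr => G _.
  by rewrite /edge_stat mulr_sumr expR_sum big_mkcondr -big_split.
rewrite sum_graph_prod.
apply: (@le_trans _ _ (expR (\sum_(e : 'I_n * 'I_n | (e.1 < e.2)%N && E e)
    w e.1 e.2 * (lam + 2 * lam ^+ 2)))); last first.
  rewrite ler_expR -mulr_suml -/(edge_mean w E) mulrDr [_ * lam]mulrC lerD2l.
  by rewrite mulrC ler_wpM2l// mulr_ge0// sqr_ge0.
rewrite expR_sum big_mkcondr; apply: ler_prod => e _.
have /andP[w0 w1] := w01 e.1 e.2.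
rewrite /f mulr1 mulr0 expR0; case: ifP => _; last first.
  by rewrite !mulr1 addrC subrK lexx ler01.
apply/andP; split; first by rewrite addr_ge0// ?mulr_ge0 ?expR_ge0//; lra.
apply: le_trans (expR_ge1Dx _).
have := expR_quadratic lam2; move: (expR lam) => y hy.
have := ler_wpM2l w0 hy; lra.
Qed.

(* Chernoff's method; [lam < 0] gives lower tails. *)
Lemma edge_stat_chernoff (R : realType) n (w : 'I_n -> 'I_n -> R)
    (E : pred ('I_n * 'I_n)) (lam V thr : R) (P : pred (graph n)) :
  (forall i j, 0 <= w i j <= 1) -> edge_mean w E <= V -> lam <= 1 / 2 ->
  (forall G, P G -> lam * thr <= lam * edge_stat R E G) ->
  prob (edge_law w) P <=
  expR (lam * (edge_mean w E - thr) + 2 * lam ^+ 2 * V).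
Proof.
move=> w01 EV lam2 hP.
have -> : lam * (edge_mean w E - thr) + 2 * lam ^+ 2 * V =
  lam * edge_mean w E + 2 * lam ^+ 2 * V - lam * thr by ring.
rewrite expRD; apply: le_trans (ler_wpM2r (expR_ge0 _) (edge_stat_mgf w01 EV lam2)).
rewrite mulr_suml /prob big_mkcond; apply: ler_sum => G _.
have wG := edge_law_ge0 G w01.
case: ifP => [PG|_]; last by rewrite !mulr_ge0 ?expR_ge0.
(* Markov's inequality: on [P] the exponential weight is at least 1. *)
rewrite -mulrA -expRD ler_peMr// -expR0 ler_expR subr_ge0; exact: hP.
Qed.

(** The choice [lam = t / (4 V)] minimises [- lam t + 2 lam^2 V], and [t <= 2 V] says precisely that
    [lam <= 1 / 2]. *)
Lemma edge_stat_upper_tail (R : realType) n (w : 'I_n -> 'I_n -> R)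
    (E : pred ('I_n * 'I_n)) (V t : R) (P : pred (graph n)) :
  (forall i j, 0 <= w i j <= 1) -> edge_mean w E <= V -> 0 < V ->
  0 <= t <= 2 * V ->
  (forall G, P G -> edge_mean w E + t <= edge_stat R E G) ->
  prob (edge_law w) P <= expR (- (t ^+ 2 / (8 * V))).
Proof.
move=> w01 EV V0 /andP[t0 tV] hP.
have lam0 : 0 <= t / (4 * V) by apply: divr_ge0 => //; lra.
have lam2 : t / (4 * V) <= 1 / 2 by rewrite ler_pdivrMr; lra.
apply: le_trans (edge_stat_chernoff w01 EV lam2 _) _.
  by move=> G PG; apply: ler_wpM2l => //; exact: hP.
rewrite ler_expR le_eqVlt; apply/orP; left; apply/eqP; field.
by rewrite gt_eqF.
Qed.

Lemma edge_stat_lower_tail (R : realType) n (w : 'I_n -> 'I_n -> R)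
    (E : pred ('I_n * 'I_n)) (V t : R) (P : pred (graph n)) :
  (forall i j, 0 <= w i j <= 1) -> edge_mean w E <= V -> 0 < V ->
  0 <= t <= 2 * V ->
  (forall G, P G -> edge_stat R E G <= edge_mean w E - t) ->
  prob (edge_law w) P <= expR (- (t ^+ 2 / (8 * V))).
Proof.
move=> w01 EV V0 /andP[t0 tV] hP.
have lam0 : 0 <= t / (4 * V) by apply: divr_ge0 => //; lra.
have lam2 : - (t / (4 * V)) <= 1 / 2 by lra.
apply: le_trans (edge_stat_chernoff w01 EV lam2 _) _.
  by move=> G PG; apply: ler_wnM2l; [lra|exact: hP].
rewrite ler_expR le_eqVlt; apply/orP; left; apply/eqP; field.
by rewrite gt_eqF.
Qed.

Lemma prob_union (R : realType) n (law : graph n -> R) (I : finType)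
    (Q : pred I) (P : pred (graph n)) (F : I -> pred (graph n)) :
  (forall G, 0 <= law G) -> (forall G, P G -> exists2 x, Q x & F x G) ->
  prob law P <= \sum_(x | Q x) prob law (F x).
Proof.
move=> law0 PF; rewrite /prob.
under [leRHS]eq_bigr do rewrite big_mkcond.
rewrite exchange_big /= big_mkcond; apply: ler_sum => G _.
have nn x : 0 <= (if F x G then law G else 0) by case: ifP.
case: ifP => [/PF[x Qx FxG]|_]; last exact: sumr_ge0.
by rewrite (bigD1 x) //= FxG lerDl sumr_ge0.
Qed.

(** * Means of the statistics under the null and planted laws *)

Lemma edge_mean_cst_crossing (R : realType) n (S T : {set 'I_n}) (a : R) :
  [disjoint S & T] ->
  edge_mean (fun _ _ => a) (crossing S T) = (#|S| * #|T|)%:R * a.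
Proof.
move=> dST; rewrite /edge_mean -(sum_crossing (f := fun _ _ => a)) //.
by rewrite !sumr_const -mulrnA mulnC mulr_natl.
Qed.

Lemma edge_mean_cst_all (R : realType) n (a : R) :
  edge_mean (fun _ _ : 'I_n => a) predT = 'C(n, 2)%:R * a.
Proof.
rewrite /edge_mean; under eq_bigl do rewrite andbT.
rewrite -(pair_big_dep predT (fun i j : 'I_n => (i < j)%N) (fun _ _ => a)) /=.
rewrite (exchange_big_dep predT) //= -bin2_sum big_mkord natr_sum mulr_suml.
apply: eq_bigr => j _.
rewrite -(big_ord_widen _ (fun _ => a) (ltnW (ltn_ord j))).
by rewrite sumr_const card_ord mulr_natl.
Qed.

Lemma edge_mean_planted (R : realType) n (p q : R) (S T : {set 'I_n})
    (E : pred ('I_n * 'I_n)) :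
  edge_mean (planted_prob p q S T) E =
  edge_mean (fun _ _ => q) E +
  edge_mean (fun _ _ => p - q) (predI E (crossing S T)).
Proof.
rewrite /edge_mean [LHS]big_mkcondr [X in _ = X + _]big_mkcondr.
rewrite [X in _ = _ + X]big_mkcondr -big_split; apply: eq_bigr => e _ /=.
rewrite /planted_prob -/(crossing S T e).
by case: (E e); case: (crossing S T e); rewrite /= ?addr0 // addrC subrK.
Qed.

Lemma edge_stat_crossing (R : realType) n (S T : {set 'I_n}) (G : graph n) :
  [disjoint S & T] ->
  edge_stat R (crossing S T) G = (\sum_(i in S) \sum_(j in T) adj G i j)%N%:R.
Proof.
move=> dST; rewrite /edge_stat.
rewrite -(sum_crossing (f := fun i j => (adj G i j)%:R)) //; last first.
  by move=> i j; rewrite adjC.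
by rewrite natr_sum; apply: eq_bigr => i _; rewrite natr_sum.
Qed.

(** Writing the edges at [v] as a crossing set lets the results on crossing sums apply to
    degrees. *)
Definition star n (v : 'I_n) : pred ('I_n * 'I_n) :=
  crossing [set v] (~: [set v]).

Lemma edge_mean_cst_star (R : realType) n (v : 'I_n) (a : R) :
  edge_mean (fun _ _ => a) (star v) = (n%:R - 1) * a.
Proof.
rewrite edge_mean_cst_crossing ?finset.disjoints_subset ?finset.setCK//.
rewrite cards1 mul1n cardsCs finset.setCK cards1 card_ord natrB//.
exact: leq_ltn_trans (leq0n v) (ltn_ord v).
Qed.

Lemma edge_stat_star (R : realType) n (v : 'I_n) (G : graph n) :
  edge_stat R (star v) G = (\sum_(j < n) adj G v j)%N%:R.
Proof.
rewrite edge_stat_crossing ?finset.disjoints_subset ?finset.setCK// big_set1.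
rewrite [in RHS](bigD1 v)//= adjii add0n; congr (_%:R).
by apply: eq_bigl => j; rewrite !inE.
Qed.

(** As [v] is in [S] and not in [T], a planted edge at [v] must have its other end in [T]. *)
Lemma star_crossing n (S T : {set 'I_n}) (v : 'I_n) :
  [disjoint S & T] -> v \in S ->
  predI (star v) (crossing S T) =1 crossing [set v] T.
Proof.
move=> dST vS [i j]; rewrite /= /star /crossing /= !inE.
have vT := disjointFr dST vS.
have [->|iv] := eqVneq i v; have [->|jv] := eqVneq j v; rewrite ?vS ?vT /=
  ?andbF ?andbT ?orbF //=.
Qed.

Lemma edge_mean_planted_star (R : realType) n (p q : R) (S T : {set 'I_n})
    (v : 'I_n) :
  [disjoint S & T] -> v \in S ->
  edge_mean (planted_prob p q S T) (star v) =
  (n%:R - 1) * q + #|T|%:R * (p - q).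
Proof.
move=> dST vS; rewrite edge_mean_planted edge_mean_cst_star; congr (_ + _).
rewrite /edge_mean
  (eq_bigl (fun e : 'I_n * 'I_n => (e.1 < e.2)%N && crossing [set v] T e)).
  rewrite -/(edge_mean (fun _ _ => p - q) (crossing [set v] T)).
  rewrite edge_mean_cst_crossing ?cards1 ?mul1n//.
  by rewrite finset.disjoints_subset finset.sub1set inE (disjointFr dST vS).
by move=> e; rewrite star_crossing.
Qed.

Lemma edge_mean_planted_all (R : realType) n (p q : R) (S T : {set 'I_n}) :
  [disjoint S & T] ->
  edge_mean (planted_prob p q S T) predT =
  'C(n, 2)%:R * q + (#|S| * #|T|)%:R * (p - q).
Proof.
move=> dST; rewrite edge_mean_planted edge_mean_cst_all.
by rewrite -(edge_mean_cst_crossing _ dST).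
Qed.

Lemma edge_mean_planted_crossing (R : realType) n (p q : R) (S T : {set 'I_n}) :
  [disjoint S & T] ->
  edge_mean (planted_prob p q S T) (crossing S T) = (#|S| * #|T|)%:R * p.
Proof.
move=> dST; rewrite -edge_mean_cst_crossing//; apply: eq_bigr => e /andP[_ eST].
by rewrite /planted_prob -/(crossing S T e) eST.
Qed.

Lemma planted_probC (R : realType) n (p q : R) (S T : {set 'I_n}) :
  planted_prob p q S T = planted_prob p q T S.
Proof. by apply/funext => i; apply/funext => j; rewrite /planted_prob orbC. Qed.

Lemma planted_prob01 (R : realType) n (p q : R) (S T : {set 'I_n}) :
  0 < q < p -> p <= 1 -> forall i j, 0 <= planted_prob p q S T i j <= 1.
Proof. by move=> /andP[? ?] ? i j; rewrite /planted_prob; case: ifP => _; lra. Qed.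

(** * Mixtures, binomial coefficients, maxima and exponents *)

Lemma average_le (R : realType) (I : finType) (P : pred I) (N : nat)
    (F : I -> R) (b : R) :
  #|P| = N -> 0 <= b -> (forall i, P i -> F i <= b) ->
  \sum_(i | P i) N%:R^-1 * F i <= b.
Proof.
move=> PN b0 Fb; apply: (@le_trans _ _ (\sum_(i | P i) N%:R^-1 * b)).
  by apply: ler_sum => i Pi; rewrite ler_wpM2l ?invr_ge0 ?Fb.
rewrite sumr_const PN -[leLHS]mulr_natl mulrA.
(* With no admissible set the average is 0, and [b0] gives the bound. *)
by have [->|N0] := eqVneq (N%:R : R) 0; rewrite ?mul0r// divff ?mul1r.
Qed.

(** The planted law is a two-stage uniform mixture, so a bound valid for every fixed pair of planted
    sets survives the averaging. *)
Lemma prob_planted_le (R : realType) n (kR kL : nat) (p q : R)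
    (P : pred (graph n)) (b : R) :
  0 <= b ->
  (forall S T : {set 'I_n}, #|S| = kR -> #|T| = kL -> [disjoint S & T] ->
    prob (edge_law (planted_prob p q S T)) P <= b) ->
  prob (planted_law kR kL p q) P <= b.
Proof.
move=> b0 hb; rewrite /prob /planted_law exchange_big /=.
under eq_bigr do rewrite -mulr_sumr.
apply: average_le => //.
  by rewrite -[in RHS](card_ord n) -card_draws; apply: eq_card => S; rewrite inE.
move=> S /eqP Sk; rewrite exchange_big /=.
under eq_bigr do rewrite -mulr_sumr.
apply: average_le => //.
  have <- : #|~: S| = (n - kR)%N by rewrite cardsCs finset.setCK card_ord Sk.
  rewrite -cards_draws.
  by apply: eq_card => T; rewrite inE.
move=> T /andP[TS /eqP Tk]; apply: hb => //.
by rewrite disjoint_sym finset.disjoints_subset.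
Qed.

(** With [x = K / n], the binomial theorem gives ['C(n, k) x^k <= (1 + x)^n <= expR K], and
    [x^K <= x^k] since [x <= 1]. Allowing [k <= K] gives both planted sizes the same bound, with [K]
    their maximum. *)
Lemma bin_le_expR (R : realType) (n k K : nat) :
  (0 < K)%N -> (k <= K <= n)%N ->
  'C(n, k)%:R <= expR (K%:R * (1 + ln (n%:R / K%:R))) :> R.
Proof.
move=> K0 /andP[kK Kn]; have n0 : (0 < n)%N by apply: leq_trans Kn.
have nR : 0 < n%:R :> R by rewrite ltr0n.
have KR : 0 < K%:R :> R by rewrite ltr0n.
pose x : R := K%:R / n%:R; have x0 : 0 < x by rewrite divr_gt0.
have x1 : x <= 1 by rewrite ler_pdivrMr// mul1r ler_nat.
have h : 'C(n, k)%:R * x ^+ k <= expR K%:R.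
  apply: (@le_trans _ _ ((1 + x) ^+ n)).
    have kn : (k < n.+1)%N by rewrite ltnS (leq_trans kK).
    rewrite exprDn (bigD1 (Ordinal kn)) //= expr1n mul1r mulr_natl lerDl.
    by apply: sumr_ge0 => i _; rewrite mulrn_wge0// mulr_ge0// exprn_ge0 ?ltW.
  have -> : K%:R = n%:R * x :> R by rewrite /x mulrC divfK ?gt_eqF.
  rewrite expRM_natl lerXn2r ?nnegrE ?expR_ge0 ?expR_ge1Dx//.
  by rewrite addr_ge0// ltW.
have -> : ln (n%:R / K%:R) = - ln x by rewrite -lnV ?posrE// invf_div.
rewrite mulrDr mulr1 mulrN expRD expRN expRM_natl lnK ?posrE//.
rewrite ler_pdivlMr ?exprn_gt0//; apply: le_trans h.
by rewrite ler_wpM2l// ler_wiXn2l// ltW.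
Qed.

(** Positivity of [thr] excludes the value 0 of an empty maximum. *)
Lemma bigmax_natr_ge (R : realType) (I : finType) (P : pred I) (F : I -> nat)
    (thr : R) :
  0 < thr -> thr <= (\max_(i | P i) F i)%:R ->
  exists2 i, P i & thr <= (F i)%:R.
Proof.
move=> thr0 thrM.
have [/existsP[i /andP[Pi Fi]]|/existsPn nF] :=
  boolP [exists i, P i && (thr <= (F i)%:R)]; first by exists i.
suff : (\max_(i | P i) F i)%:R < thr by rewrite ltNge thrM.
elim/big_ind: _ => // [a b|i Pi]; last by have := nF i; rewrite Pi -ltNge.
by rewrite natr_max gt_max => -> ->.
Qed.

Lemma expRN_ln_half (R : realType) (delta : R) :
  0 < delta -> expR (- ln (2 / delta)) = delta / 2.
Proof. by move=> d0; rewrite expRN lnK ?posrE ?divr_gt0// invf_div. Qed.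

(** The tail exponent for deviation [s / 2] and [V = K m q] equals [(s^2 / q) / (32 K m)]; this is
    the source of the constant 32. *)
Lemma prob_tail_le (R : realType) (K m q s L : R) (pr : R) :
  0 < K -> 0 < m -> 0 < q -> 32 * K * m * L <= s ^+ 2 / q ->
  pr <= expR (- ((s / 2) ^+ 2 / (8 * (K * m * q)))) -> pr <= expR (- L).
Proof.
move=> K0 m0 q0 h /le_trans; apply; rewrite ler_expR lerN2.
have -> : (s / 2) ^+ 2 / (8 * (K * m * q)) = (s ^+ 2 / q) / (32 * K * m).
  by field; rewrite !gt_eqF.
by rewrite ler_pdivlMr ?mulr_gt0// mulrC.
Qed.

(** * Risk bounds for the three tests; each error gets [delta / 2] *)

(** The constant 128 is 4 times 32: the exponent [4 (k l + L)] must absorb the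
    [2 k (1 + l) <= 4 k l] of the union bound and still leave at least [L]. *)
Lemma scan_risk (R : realType) n (kR kL : nat) (p q K delta : R) :
  (0 < kR)%N -> (0 < kL)%N -> (4 * maxn kR kL <= n)%N ->
  0 < q < p -> p <= 1 -> p <= K * q -> 0 < delta < 1 ->
  128 * K * ((maxn kR kL)%:R * ln (n%:R / (maxn kR kL)%:R) + ln (2 / delta)) <=
    (kR * kL)%:R * ((p - q) ^+ 2 / q) ->
  risk kR kL p q (@scan_test R n kR kL p q) <= delta.
Proof.
move=> kR0 kL0 k4 /[dup] qp /andP[q0 pq] p1 pK /andP[d0 d1] hx.
have K1 : 1 < K by rewrite -(ltr_pM2r q0) mul1r (lt_le_trans pq).
have m0 : 0 < (kR * kL)%:R :> R by rewrite ltr0n muln_gt0 kR0.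
move: hx; set k := maxn kR kL; set m : R := (kR * kL)%:R.
set l := ln (n%:R / k%:R); set L := ln (2 / delta) => hx.
have k0 : (0 < k)%N by rewrite /k leq_max kR0.
have kn : (k <= n)%N by rewrite (leq_trans _ k4)// leq_pmull.
have kk : 1 <= k%:R :> R by rewrite ler1n.
have l1 : 1 <= l.
  rewrite -[leLHS]expRK ler_ln ?posrE ?expR_gt0 ?divr_gt0 ?ltr0n//.
    rewrite ler_pdivlMr ?ltr0n//; apply: le_trans (_ : 4 * k%:R <= _).
      rewrite ler_wpM2r//.
      (* Squaring this gives [expR 1 <= 4 <= n / k], hence [l >= 1]. *)
      have h : expR (1 / 2) <= 2 :> R.
        by apply: le_trans (expR_quadratic (lexx _)) _; lra.
      have -> : 1 = 2%:R * (1 / 2) :> R by field.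
      by rewrite expRM_natl (le_trans (lerXn2r _ _ _ h)) ?nnegrE ?expR_ge0//; lra.
    by rewrite -natrM ler_nat.
  exact: leq_trans kn.
have L0 : 0 <= L by apply: ln_ge0; rewrite ler_pdivlMr; lra.
have tail (w : 'I_n -> 'I_n -> R) (P : pred (graph n)) :
    prob (edge_law w) P <=
      expR (- ((m * (p - q) / 2) ^+ 2 / (8 * (K * m * q)))) ->
    prob (edge_law w) P <= expR (- (4 * (k%:R * l + L))).
  apply: prob_tail_le => //; first lra.
  have := ler_wpM2l (ltW m0) hx; rewrite -/m; lra.
have tV : 0 <= m * (p - q) / 2 <= 2 * (K * m * q).
  have : m * (p - q) <= m * (K * q) by rewrite ler_wpM2l ?ltW//; lra.
  have : 0 <= m * (p - q) by rewrite mulr_ge0//; lra.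
  by move=> ? ?; apply/andP; split; lra.
have V0 : 0 < K * m * q by rewrite !mulr_gt0//; lra.
have -> : delta = delta / 2 + delta / 2 by field.
have small : expR (- (4 * (k%:R * l + L))) <= delta / 2.
  rewrite -(expRN_ln_half d0) ler_expR -/L.
  have : 0 <= k%:R * l by rewrite mulr_ge0//; lra.
  lra.
apply: lerD.
  pose Q (ST : {set 'I_n} * {set 'I_n}) :=
    [&& #|ST.1| == kR, #|ST.2| == kL & [disjoint ST.1 & ST.2]].
  pose F (ST : {set 'I_n} * {set 'I_n}) : pred (graph n) :=
    [pred G | m * ((p + q) / 2) <= edge_stat R (crossing ST.1 ST.2) G].
  apply: (le_trans (prob_union (Q := Q) (F := F) _ _)).
  - by move=> G; apply: edge_law_ge0 => _ _; lra.
  - move=> G /= hG; have [|ST QST hST] := bigmax_natr_ge _ hG.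
      by rewrite mulr_gt0//; lra.
    exists ST => //; rewrite /F /= edge_stat_crossing//; by case/and3P: QST.
  apply: (@le_trans _ _ (\sum_(ST | Q ST) expR (- (4 * (k%:R * l + L))))).
    apply: ler_sum => -[S T] /and3P[/= /eqP Sk /eqP Tk dST].
    apply: tail => //.
    apply: (edge_stat_upper_tail (E := crossing S T)) => //.
    - by move=> _ _; lra.
    - rewrite edge_mean_cst_crossing// Sk Tk -/m.
      by rewrite -mulrA ler_peMl ?mulr_ge0//; lra.
    move=> G /=; rewrite /F edge_mean_cst_crossing// Sk Tk -/m /=; lra.
  (* Forgetting disjointness makes the number of terms a product of two binomial coefficients. *)
  apply: (@le_trans _ _ (\sum_(ST : {set 'I_n} * {set 'I_n} |
      (#|ST.1| == kR) && (#|ST.2| == kL)) expR (- (4 * (k%:R * l + L))))).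
    rewrite /Q [leLHS]big_mkcond [leRHS]big_mkcond; apply: ler_sum => ST _.
    by case: (_ == _); case: (_ == _); case: [disjoint _ & _]; rewrite ?expR_ge0.
  have card r : #|[pred S : {set 'I_n} | #|S| == r]| = 'C(n, r).
    rewrite -[in RHS](card_ord n) -card_draws.
    by apply: eq_card => S; rewrite !inE.
  rewrite -(pair_big (fun S : {set 'I_n} => #|S| == kR)
    (fun T : {set 'I_n} => #|T| == kL) (fun _ _ => _)) /= !sumr_const !card.
  rewrite -mulrnA -[leLHS]mulr_natl natrM.
  have b1 := @bin_le_expR R n kL k k0; have b2 := @bin_le_expR R n kR k k0.
  rewrite /k leq_max leqnn orbT -/k kn in b1.
  rewrite /k leq_max leqnn -/k kn in b2.
  have {b1 b2} b := ler_pM (ler0n _ _) (ler0n _ _) (b1 isT) (b2 isT).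
  apply: (le_trans (ler_wpM2r (expR_ge0 _) b)).
  rewrite -!expRD -(expRN_ln_half d0) ler_expR -/l -/L.
  have : k%:R * 1 <= k%:R * l by rewrite ler_wpM2l.
  lra.
apply: prob_planted_le; first lra.
move=> S T Sk Tk dST; apply: le_trans small; apply: tail => //.
apply: (edge_stat_lower_tail (E := crossing S T)) => //.
- exact: planted_prob01.
- rewrite edge_mean_planted_crossing// Sk Tk -/m.
  by rewrite [K * m]mulrC -mulrA ler_wpM2l// ltW.
move=> G /=; rewrite -ltNge => hG.
rewrite edge_mean_planted_crossing// Sk Tk -/m edge_stat_crossing//.
(* The planted pair is itself a candidate in the scan, so a small scan forces its own edge sum to be
   small. *)
apply: (@le_trans _ _ (scan kR kL G)%:R).
  rewrite ler_nat /scan (bigD1 (S, T)) ?leq_maxl//=.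
  by rewrite Sk Tk !eqxx.
by move: hG; rewrite /scan_test -/m; lra.
Qed.

Lemma count_risk (R : realType) n (kR kL : nat) (p q K delta : R) :
  (0 < n)%N -> (kR * kL <= n ^ 2)%N ->
  0 < q < p -> p <= 1 -> p <= K * q -> 0 < delta < 1 ->
  32 * K * (n%:R ^+ 2 * ln (2 / delta)) <=
    (kR * kL)%:R ^+ 2 * ((p - q) ^+ 2 / q) ->
  risk kR kL p q (@count_test R n kR kL p q) <= delta.
Proof.
move=> n0 kn /[dup] qp /andP[q0 pq] p1 pK /andP[d0 d1] hx.
have K1 : 1 < K by rewrite -(ltr_pM2r q0) mul1r (lt_le_trans pq).
have {}kn : (kR * kL)%:R <= n%:R ^+ 2 :> R by rewrite -natrX ler_nat.
have {}n0 : 0 < n%:R ^+ 2 :> R by rewrite exprn_gt0// ltr0n.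
(* This crude bound allows [V = K n^2 q] under both hypotheses. *)
have Nn : 'C(n, 2)%:R <= n%:R ^+ 2 :> R.
  rewrite -natrX ler_nat bin2.
  rewrite (leq_trans (half_leq (leq_mul (leqnn n) (leq_pred n))))//.
  by rewrite -mulnn -divn2 leq_div.
have countE (G : graph n) : (edge_count G)%:R = edge_stat R predT G.
  by rewrite /edge_count /edge_stat natr_sum; apply: eq_bigl => e; rewrite andbT.
move: hx kn; set m : R := (kR * kL)%:R; set N : R := 'C(n, 2)%:R => hx kn.
have m0 : 0 <= m := ler0n _ _.
have tail (w : 'I_n -> 'I_n -> R) (P : pred (graph n)) :
    prob (edge_law w) P <=
      expR (- ((m * (p - q) / 2) ^+ 2 / (8 * (K * n%:R ^+ 2 * q)))) ->
    prob (edge_law w) P <= delta / 2.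
  rewrite -(expRN_ln_half d0); apply: prob_tail_le => //; first lra.
  by rewrite exprMn; lra.
have V0 : 0 < K * n%:R ^+ 2 * q by rewrite mulr_gt0// mulr_gt0//; lra.
have tV : 0 <= m * (p - q) / 2 <= 2 * (K * n%:R ^+ 2 * q).
  have : m * (p - q) <= n%:R ^+ 2 * (K * q) by apply: ler_pM => //; lra.
  have : 0 <= m * (p - q) by rewrite mulr_ge0//; lra.
  by move=> ? ?; apply/andP; split; lra.
have NV a : 0 <= a <= K * q -> N * a <= K * n%:R ^+ 2 * q.
  move=> /andP[a0 aK]; rewrite [K * _]mulrC -mulrA.
  by apply: ler_pM => //; exact: ler0n.
have -> : delta = delta / 2 + delta / 2 by field.
apply: lerD.
  apply: tail; apply: (edge_stat_upper_tail (E := predT)) => //.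
  - by move=> _ _; lra.
  - by rewrite edge_mean_cst_all; apply: NV; lra.
  by move=> G /=; rewrite /count_test edge_mean_cst_all countE -/m -/N; lra.
apply: prob_planted_le; first lra.
move=> S T Sk Tk dST; apply: tail.
apply: (edge_stat_lower_tail (E := predT)) => //.
- exact: planted_prob01.
(* The planted mean is at most that of the graph with [p] on every edge. *)
- apply: (@le_trans _ _ (edge_mean (fun _ _ : 'I_n => p) predT)).
    by apply: ler_sum => e _; rewrite /planted_prob; case: ifP; lra.
  by rewrite edge_mean_cst_all; apply: NV; lra.
move=> G /=; rewrite /count_test -ltNge countE edge_mean_planted_all// Sk Tk.
by rewrite -/m -/N; lra.
Qed.

(** One planted vertex suffices, since its degree bounds the maximum from below. Its mean degree
    exceeds [(n - 1) q] by [k (p - q)], where [k] is the size of the side opposite to it. *)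
Lemma deg_lower_tail (R : realType) n (p q K k L : R) (S T : {set 'I_n})
    (v : 'I_n) (P : pred (graph n)) :
  0 < q < p -> p <= 1 -> p <= K * q -> [disjoint S & T] -> v \in S ->
  #|T|%:R = k -> k <= n%:R ->
  32 * K * (n%:R * L) <= k ^+ 2 * ((p - q) ^+ 2 / q) ->
  (forall G, P G -> (max_deg G)%:R <= (n%:R - 1) * q + k * ((p - q) / 2)) ->
  prob (edge_law (planted_prob p q S T)) P <= expR (- L).
Proof.
move=> /[dup] qp /andP[q0 pq] p1 pK dST vS Tk kn hx hP.
have K1 : 1 < K by rewrite -(ltr_pM2r q0) mul1r (lt_le_trans pq).
have k0 : 0 <= k by rewrite -Tk.
have n0 : 0 < n%:R :> R by rewrite ltr0n (leq_ltn_trans (leq0n v)).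
apply: (prob_tail_le (K := K) (m := n%:R) (q := q) (s := k * (p - q))) => //.
- by lra.
- by rewrite exprMn; lra.
apply: (edge_stat_lower_tail (E := star v)) => //.
- exact: planted_prob01.
- apply: (@le_trans _ _ (edge_mean (fun _ _ : 'I_n => p) (star v))).
    by apply: ler_sum => e _; rewrite /planted_prob; case: ifP; lra.
  rewrite edge_mean_cst_star [K * _]mulrC -mulrA.
  apply: (@le_trans _ _ (n%:R * p)); first lra.
  by rewrite ler_wpM2l// ltW.
- by rewrite !mulr_gt0//; lra.
- have : k * (p - q) <= n%:R * (K * q) by apply: ler_pM => //; lra.
  have : 0 <= k * (p - q) by rewrite mulr_ge0//; lra.
  by move=> ? ?; apply/andP; split; lra.
move=> G /hP hG; rewrite edge_mean_planted_star// Tk edge_stat_star.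
apply: (@le_trans _ _ (max_deg G)%:R); last lra.
by rewrite ler_nat (leq_bigmax (F := fun i : 'I_n => \sum_(j < n) adj G i j)%N).
Qed.

Lemma deg_risk (R : realType) n (kR kL : nat) (p q K delta : R) :
  (0 < kR)%N -> (0 < kL)%N -> (maxn kR kL <= n)%N ->
  0 < q < p -> p <= 1 -> p <= K * q -> 0 < delta < 1 ->
  32 * K * (n%:R * (ln n%:R + ln (2 / delta))) <=
    (maxn kR kL)%:R ^+ 2 * ((p - q) ^+ 2 / q) ->
  risk kR kL p q (@deg_test R n kR kL p q) <= delta.
Proof.
move=> kR0 kL0 kn /[dup] qp /andP[q0 pq] p1 pK /andP[d0 d1] hx.
have K1 : 1 < K by rewrite -(ltr_pM2r q0) mul1r (lt_le_trans pq).
have n0 : (0 < n)%N by rewrite (leq_trans _ kn)// leq_max kR0.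
have k0 : (0 < maxn kR kL)%N by rewrite leq_max kR0.
have knR : (maxn kR kL)%:R <= n%:R :> R by rewrite ler_nat.
have kR1 : 0 < (maxn kR kL)%:R :> R by rewrite ltr0n.
have n1 : 1 <= n%:R :> R by rewrite ler1n.
have ln0 : 0 <= ln n%:R :> R by exact: ln_ge0.
have -> : delta = delta / 2 + delta / 2 by field.
have small : expR (- (ln n%:R + ln (2 / delta))) <= delta / 2.
  by rewrite -(expRN_ln_half d0) ler_expR; lra.
apply: lerD.
  pose F (v : 'I_n) : pred (graph n) :=
    [pred G | (n%:R - 1) * q + (maxn kR kL)%:R * ((p - q) / 2) <=
              edge_stat R (star v) G].
  apply: (le_trans (prob_union (Q := predT) (F := F) _ _)).
  - by move=> G; apply: edge_law_ge0 => _ _; lra.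
  - move=> G /= hG; have [|v _ hv] := bigmax_natr_ge _ hG.
      have : 0 <= (n%:R - 1) * q by rewrite mulr_ge0//; lra.
      have : 0 < (maxn kR kL)%:R * ((p - q) / 2) by rewrite mulr_gt0//; lra.
      lra.
    by exists v => //; rewrite /F /= edge_stat_star.
  apply: (@le_trans _ _ (\sum_(v : 'I_n) expR (- (ln n%:R + ln (2 / delta))))).
    apply: ler_sum => v _.
    apply: (prob_tail_le (K := K) (m := n%:R) (q := q)
      (s := (maxn kR kL)%:R * (p - q))) => //.
    - by lra.
    - by lra.
    - by rewrite exprMn; lra.
    apply: (edge_stat_upper_tail (E := star v)) => //.
    - by move=> _ _; lra.
    - rewrite edge_mean_cst_star ler_pM2r//.
      have : 1 * n%:R <= K * n%:R by rewrite ler_wpM2r//; lra.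
      lra.
    - by rewrite !mulr_gt0//; lra.
    - have : (maxn kR kL)%:R * (p - q) <= n%:R * (K * q) by apply: ler_pM => //; lra.
      have : 0 <= (maxn kR kL)%:R * (p - q) by rewrite mulr_ge0//; lra.
      by move=> ? ?; apply/andP; split; lra.
    by move=> G /=; rewrite /F edge_mean_cst_star /=; lra.
  (* The [ln n] in the exponent cancels the number [n] of stars. *)
  rewrite sumr_const card_ord -[leLHS]mulr_natl opprD expRD (expRN_ln_half d0).
  by rewrite expRN lnK ?posrE ?ltr0n// mulrA divff ?mul1r// gt_eqF// ltr0n.
apply: prob_planted_le; first lra.
move=> S T Sk Tk dST; apply: le_trans small.
set P := (X in prob _ X).
have hP G : P G -> (max_deg G)%:R <=
    (n%:R - 1) * q + (maxn kR kL)%:R * ((p - q) / 2).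
  by rewrite /P /= /deg_test -ltNge => /ltW.
(* The vertex is taken from the smaller side, so that the side opposite to it has size
   [maxn kR kL]. *)
have [kLR|kRL] := leqP kL kR.
  have /card_gt0P[v vT] : (0 < #|T|)%N by rewrite Tk.
  rewrite planted_probC; apply: (deg_lower_tail (v := v)) pK _ _ _ knR hx hP => //.
    by rewrite disjoint_sym.
  by rewrite Sk (maxn_idPl kLR).
have /card_gt0P[v vS] : (0 < #|S|)%N by rewrite Sk.
apply: (deg_lower_tail (v := v)) pK _ _ _ knR hx hP => //.
by rewrite Tk (maxn_idPr (ltnW kRL)).
Qed.

(** * From the chi-square conditions to the risk bounds *)

(** Since [(p - q)^2 / q = (1 - q) chi2 p q], bounding [q] by [c] costs a factor [1 - c]. The factor
    [B] serves to clear the denominators of [f]. *)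
Lemma le_of_chi2 (R : realType) (p q c a f B : R) :
  0 < q -> q < c -> c < 1 -> 0 <= B -> a / (1 - c) * f <= chi2 p q ->
  a * (B * f) <= B * ((p - q) ^+ 2 / q).
Proof.
move=> q0 qc c1 B0 h.
have chi0 : 0 <= chi2 p q.
  by apply: divr_ge0; [exact: sqr_ge0|apply: mulr_ge0; lra].
have -> : (p - q) ^+ 2 / q = (1 - q) * chi2 p q.
  by rewrite /chi2; field; rewrite !gt_eqF//; lra.
rewrite mulrCA ler_wpM2l//.
apply: (@le_trans _ _ ((1 - c) * chi2 p q)); last by rewrite ler_wpM2r//; lra.
by rewrite [leRHS]mulrC -ler_pdivrMr 1?mulrAC; last lra.
Qed.

Local Open Scope classical_set_scope.
Local Open Scope ring_scope.

(** [C] is fixed before [delta] and the sequences, so it depends on [c] and [M] alone. The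
    conditions on [chi2] are implications at each [n]; only the standing assumptions are
    asymptotic. *)
Theorem theorem2 (R : realType) (c M : R) (hc : 0 < c < 1) (hM : 0 < M) :
  exists2 C : R, 0 < C &
  forall (delta : R) (kR kL : nat -> nat) (p q : nat -> R),
    0 < delta < 1 ->
    (\forall n \near \oo,
       [/\ (0 < kR n)%N /\ (0 < kL n)%N,
           0 < q n < p n, p n <= 1, q n < c &
           `|p n - q n| <= M * q n]) ->
    (fun n : nat => (kR n + kL n)%:R : R^o) =o_\oo (fun n : nat => n%:R : R^o) ->
    \forall n \near \oo,
      [/\ C * ((ln (n%:R / (maxn (kR n) (kL n))%:R)
                + ln (2 / delta) / (maxn (kR n) (kL n))%:R)
               / (minn (kR n) (kL n))%:R) <= chi2 (p n) (q n) ->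
          risk (kR n) (kL n) (p n) (q n)
            (@scan_test R n (kR n) (kL n) (p n) (q n)) <= delta,
          C * (n%:R ^+ 2 / ((kR n)%:R ^+ 2 * (kL n)%:R ^+ 2) * ln (2 / delta))
            <= chi2 (p n) (q n) ->
          risk (kR n) (kL n) (p n) (q n)
            (@count_test R n (kR n) (kL n) (p n) (q n)) <= delta &
          C * (n%:R / (maxn (kR n ^ 2) (kL n ^ 2))%:R
               * (ln n%:R + ln (2 / delta))) <= chi2 (p n) (q n) ->
          risk (kR n) (kL n) (p n) (q n)
            (@deg_test R n (kR n) (kL n) (p n) (q n)) <= delta].
Proof.
have /andP[c0 c1] := hc.
(* Here 128 is what the scan requires, the other two tests requiring 32; [1 + M] is the ratio bound
   [K], and [1 - c] comes from [le_of_chi2]. *)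
exists (128 * (1 + M) / (1 - c)); first by rewrite divr_gt0//; lra.
(* The little-o hypothesis at [1 / 4] yields [4 (kR + kL) <= n] for large [n]. *)
move=> delta kR kL p q d01 hyp /eqoP/(_ (1 / 4)) small.
have {}small := small ltac:(lra).
near=> n.
have [[kR0 kL0] /[dup] qp /andP[q0 pq] p1 qc dM] :
  [/\ (0 < kR n)%N /\ (0 < kL n)%N, 0 < q n < p n, p n <= 1, q n < c &
      `|p n - q n| <= M * q n] by near: n.
have k4 : (4 * maxn (kR n) (kL n) <= n)%N.
  have : `|(kR n + kL n)%:R : R^o| <= 1 / 4 * `|n%:R : R^o| by near: n.
  rewrite !normr_nat => h.
  have {}h : (4 * (kR n + kL n))%:R <= n%:R :> R by rewrite natrM; lra.
  rewrite ler_nat in h; apply: leq_trans h.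
  by rewrite leq_mul2l /= geq_max leq_addr leq_addl.
have kn : (maxn (kR n) (kL n) <= n)%N by apply: leq_trans k4; rewrite leq_pmull.
have pK : p n <= (1 + M) * q n.
  by move: dM; rewrite ger0_norm; lra.
have kRn : (kR n <= n)%N by rewrite (leq_trans _ kn)// leq_maxl.
have kLn : (kL n <= n)%N by rewrite (leq_trans _ kn)// leq_maxr.
have n0 : (0 < n)%N by apply: leq_trans kRn.
have kR0' : (kR n)%:R != 0 :> R by rewrite pnatr_eq0 -lt0n.
have kL0' : (kL n)%:R != 0 :> R by rewrite pnatr_eq0 -lt0n.
split.
- move=> /(le_of_chi2 q0 qc c1 (ler0n _ (kR n * kL n))) h.
  apply: scan_risk pK _ _ => //; apply: le_trans h.
  rewrite le_eqVlt; apply/orP; left; apply/eqP.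
  (* Dividing [kR kL] by the minimum leaves the maximum, which then cancels the denominator under
     [ln (2 / delta)]. *)
  have -> : (kR n * kL n = maxn (kR n) (kL n) * minn (kR n) (kL n))%N.
    by case: (leqP (kR n) (kL n)); rewrite // mulnC.
  rewrite natrM.
  by field; rewrite !pnatr_eq0 -!lt0n leq_max leq_min kR0 kL0.
- move=> /(le_of_chi2 q0 qc c1 (sqr_ge0 (kR n * kL n)%:R)) h.
  apply: count_risk pK _ _ => //.
    by rewrite -mulnn leq_mul.
  apply: le_trans h.
  have -> : (kR n * kL n)%:R ^+ 2 *
      (n%:R ^+ 2 / ((kR n)%:R ^+ 2 * (kL n)%:R ^+ 2) * ln (2 / delta)) =
      n%:R ^+ 2 * ln (2 / delta) by rewrite natrM; field; rewrite kR0' kL0'.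
  (* Passing from 128 down to 32 requires the common factor to be nonnegative, which holds as
     [2 / delta >= 1]. *)
  apply: ler_wpM2r; last by lra.
  by rewrite mulr_ge0 ?sqr_ge0// ln_ge0// ler_pdivlMr; lra.
- move=> /(le_of_chi2 q0 qc c1 (sqr_ge0 (maxn (kR n) (kL n))%:R)) h.
  apply: deg_risk pK _ _ => //.
  apply: le_trans h.
  have -> : (maxn (kR n ^ 2) (kL n ^ 2) = maxn (kR n) (kL n) ^ 2)%N.
    by case: (leqP (kR n) (kL n)) => h;
      [apply/maxn_idPr|apply/maxn_idPl]; rewrite leq_exp2r// ltnW.
  have -> : (maxn (kR n) (kL n))%:R ^+ 2 *
      (n%:R / (maxn (kR n) (kL n) ^ 2)%N%:R * (ln n%:R + ln (2 / delta))) =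
      n%:R * (ln n%:R + ln (2 / delta)).
    by rewrite natrX; field; rewrite pnatr_eq0 -lt0n leq_max kR0.
  apply: ler_wpM2r; last by lra.
  rewrite mulr_ge0// addr_ge0// ln_ge0 ?ler1n//.
  by rewrite ler_pdivlMr; lra.
Unshelve. all: by end_near. Qed.
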